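(* Let $G$ be a Garside group with positive monoid $G^+\neq\{1\}$, Garside element $\Delta$ and set $\mathcal D$ of simple elements. Let $N=\|\Delta\|$ and let $g\in G$. Then there exists a positive integer $n\le N^2$ such that every element of the super summit set $[g^n]^S$ of $g^n$ is periodically geodesic with respect to $\mathcal D$.
   Context: Garside groups. Let $M$ be a monoid. An atom is an element $a\in M\setminus\{1\}$ such that $a=bc$ implies $b=1$ or $c=1$. For $a\in M$, $\|a\|$ is the supremum of the lengths of all expressions of $a$ as a product of atoms. $M$ is atomic if it is generated by its atoms and $\|a\|<\infty$ for all $a\in M$. In an atomic monoid, $a\le_L b$ means $ac=b$ for some $c\in M$, and $a\le_R b$ means $ca=b$ for some $c\in M$; these are partial orders. An atomic monoid $M$ is a Garside monoid if (i) $M$ is finitely generated; (ii) $M$ is left and right cancellative; (iii) $(M,\le_L)$ and $(M,\le_R)$ are lattices; (iv) there is an element $\Delta\in M$ (a Garside element) such that for each $a\in M$, $a\le_L\Delta$ if and only if $a\le_R\Delta$, and the set $\{a\in M: a\le_L\Delta\}$ generates $M$. The set of simple elements is $\mathcal D=\{a\in M: a\le_L\Delta\}$ (a finite set). A Garside monoid embeds in its group of fractions $G$, which is called a Garside group; $M$ is identified with its image in $G$, denoted $G^+$ and called the positive monoid. For $g,h\in G$, $g\le_L h$ means $gc=h$ for some $c\in G^+$. Invariants. For $g\in G$, $\inf(g)=\max\{r\in\mathbb Z:\Delta^r\le_L g\}$ and $\sup(g)=\min\{s\in\mathbb Z: g\le_L\Delta^s\}$. Let $[g]=\{h^{-1}gh: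 h\in G\}$ be the conjugacy class, $\inf_s(g)=\max\{\inf(h):h\in[g]\}$ and $\sup_s(g)=\min\{\sup(h):h\in[g]\}$. The super summit set is $[g]^S=\{h\in[g]:\inf(h)=\inf_s(g),\ \sup(h)=\sup_s(g)\}$ (finite and nonempty). Word length. $|g|_{\mathcal D}$ denotes the shortest length of a word over the alphabet $\mathcal D\cup\mathcal D^{-1}$ representing $g$. An element $h\in G$ is periodically geodesic with respect to $\mathcal D$ if $|h^n|_{\mathcal D}=|n|\cdot|h|_{\mathcal D}$ for all $n\in\mathbb Z$. *)

(* Defs.v *)
From HB Require Import structures.
From mathcomp Require Import all_boot all_order all_algebra.
From mathcomp Require Import boolp classical_sets cardinality.

Set Implicit Arguments.
Unset Strict Implicit.
Unset Printing Implicit Defensive.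

Import Order.TTheory.
Local Open Scope classical_set_scope.
Local Open Scope group_scope.

(* Greatest and least elements; the default value x0 is returned only when
   there is no such element. *)
Definition maximum d (T : porderType d) (x0 : T) (A : set T) : T :=
  xget x0 (A `&` ubound A).

Definition minimum d (T : porderType d) (x0 : T) (A : set T) : T :=
  xget x0 (A `&` lbound A).

Section Monoids.
Variable M : monoidType.
Implicit Types (a b c : M) (A : set M) (s : seq M).

Definition word_over A s : Prop := forall x, x \in s -> A x.

Definition generates A : Prop :=
  forall a, exists2 s, word_over A s & \prod_(x <- s) x = a.

Definition atom a : Prop :=
  a <> 1 /\ forall b c, a = b * c -> b = 1 \/ c = 1.

Definition atom_lengths a : set nat :=
  [set size s | s in [set s | word_over atom s /\ \prod_(x <- s) x = a]].

(* The value is meaningful only when the lengths are bounded (otherwise the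
   supremum is infinite); boundedness is part of [atomic]. *)
Definition atom_norm a : nat := supremum 0 (atom_lengths a).

Definition atomic : Prop :=
  generates atom /\ forall a, has_ubound (atom_lengths a).

Definition leL a b : Prop := exists c, a * c = b.
Definition leR a b : Prop := exists c, c * a = b.

Definition is_lattice (le : M -> M -> Prop) : Prop :=
  [/\ forall a, le a a,
      forall a b, le a b -> le b a -> a = b,
      forall b a c, le a b -> le b c -> le a c,
      forall a b, exists m,
        [/\ le m a, le m b & forall c, le c a -> le c b -> le c m]
    & forall a b, exists j,
        [/\ le a j, le b j & forall c, le a c -> le b c -> le j c]].

Definition garside_element (Delta : M) : Prop :=
  (forall a, leL a Delta <-> leR a Delta) /\
  generates [set a | leL a Delta].

Record garside_monoid (Delta : M) : Prop := GarsideMonoid {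
  garside_atomic : atomic;
  garside_fg : exists A, finite_set A /\ generates A;
  garside_cancelL : forall a b c, a * b = a * c -> b = c;
  garside_cancelR : forall a b c, b * a = c * a -> b = c;
  garside_latticeL : is_lattice leL;
  garside_latticeR : is_lattice leR;
  garside_delta : garside_element Delta
}.

End Monoids.

Section Groups.
Variable G : groupType.
Implicit Types (g h : G) (A : set G) (n : int).

Definition expgz g n : G :=
  match n with Posz k => g ^+ k | Negz k => g ^- k.+1 end.

Definition conj_class g : set G := [set g ^ h | h in setT].

Definition word_length A g : nat :=
  minimum 0 [set size w | w in
    [set w : seq G | word_over (A `|` [set x^-1 | x in A]) w
                     /\ \prod_(x <- w) x = g]].

Definition periodically_geodesic A h : Prop :=
  forall n, word_length A (expgz h n) = (`|n| * word_length A h)%N.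

End Groups.

(* G is the group of fractions of M along iota; the positive monoid is the
   image of iota. *)
Definition group_of_fractions (M : monoidType) (G : groupType)
    (iota : UMagmaMorphism.type M G) : Prop :=
  injective iota /\ forall g : G, exists a b : M, g = iota a / iota b.

Section GarsideGroups.
Variables (M : monoidType) (G : groupType).
Variables (iota : UMagmaMorphism.type M G) (Delta : M).
Implicit Types (g h : G).

Definition positive : set G := range iota.

Definition simples : set G := [set iota a | a in [set a | leL a Delta]].

Definition leG g h : Prop := exists2 c, positive c & g * c = h.

Definition inf_G g : int :=
  maximum 0%R [set r : int | leG (expgz (iota Delta) r) g].

Definition sup_G g : int :=
  minimum 0%R [set s : int | leG g (expgz (iota Delta) s)].

Definition inf_s g : int := maximum 0%R [set inf_G h | h in conj_class g].
Definition sup_s g : int := minimum 0%R [set sup_G h | h in conj_class g].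

Definition super_summit_set g : set G :=
  [set h | [/\ conj_class g h, inf_G h = inf_s g & sup_G h = sup_s g]].

End GarsideGroups.

(* Main.v *)
Require Import Defs.
From HB Require Import structures.
From mathcomp Require Import all_boot all_order all_algebra.
From mathcomp Require Import boolp classical_sets cardinality.
From mathcomp Require Import zify.

Local Open Scope classical_set_scope.
Local Open Scope group_scope.

(* Write [x >= r] for the existence of a conjugate of [x] with inf at least
   [r], i.e. of some [u] with [u <= T u] for the order automorphism
   [T u = x u Delta^-r] of the lattice [G].  If [g^k >= b], the joins
   of the translates [g^n u Delta^-m], sorted by the value of [n b - m k], form a
   monotone family [X_i] (i in Z) with [X_(i+k) = X_i Delta] and
   [X_(i+b) <= g X_i].  Since [Delta] has length [N], this family jumps at most
   [N] times per period; moving from a jump [i] to the first jump after [i + b]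
   therefore returns, within [N] steps, to the same jump up to a period, and
   this gives [g^q >= p] with [q <= N] and [p / q >= b / k].
   Hence the limit of inf(g^k) / k is a fraction [p1 / q1] with [q1 <= N] which
   is already reached by [inf_s (g^q1) = p1], and likewise [p2 / q2] for [g^-1].
   For [n = q1 q2] and [h] in the super summit set of [g^n], inf and sup are then
   linear on the positive powers of [h], and the word length of any [x] is
   max(0, sup x) + max(0, - inf x). *)

(** * Extrema of sets of integers *)

Section Extrema.
Set Implicit Arguments.
Unset Strict Implicit.
Import Order.TTheory GRing.Theory Num.Theory.

Lemma maximumE d (T : porderType d) (x0 x : T) (A : set T) :
  A x -> ubound A x -> maximum x0 A = x.
Proof.
move=> Ax ubx; apply: xget_unique => // y [Ay uby].
by apply/eqP; rewrite eq_le ubx //= uby.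
Qed.

Lemma minimumE d (T : porderType d) (x0 x : T) (A : set T) :
  A x -> lbound A x -> minimum x0 A = x.
Proof.
move=> Ax lbx; apply: xget_unique => // y [Ay lby].
by apply/eqP; rewrite eq_le lby //= lbx.
Qed.

Lemma int_set_max (A : set int) (r0 r1 : int) :
  A r0 -> ubound A r1 -> exists2 p, A p & ubound A p.
Proof.
move=> A0 ub1.
have ex : exists n, `[< A (r0 + n%:Z)%R >].
  by exists 0; apply/asboolP; rewrite addr0.
have ub n : `[< A (r0 + n%:Z)%R >] -> (n <= `|r1 - r0|)%N.
  by move=> /asboolP /ub1; lia.
case: (ex_maxnP ex ub) => m /asboolP Am maxm.
exists (r0 + m%:Z)%R => // r Ar.
case: (lerP r r0) => [|lt_r0r]; first by lia.
have := maxm `|r - r0|%N; rewrite (_ : r0 + _ = r)%R; last by lia.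
by move=> /(_ (introT (asboolP _) Ar)); lia.
Qed.

End Extrema.

(** * Integer powers in a group *)

Section IntegerPowers.
Set Implicit Arguments.
Unset Strict Implicit.
Import Order.TTheory GRing.Theory Num.Theory.
Variable G : groupType.
Implicit Types (g : G) (m n : int).

Lemma expgzN g n : expgz g (- n)%R = (expgz g n)^-1.
Proof. by case: n => [[|n]|n] //=; rewrite ?expg0 ?invg1 ?invgK. Qed.

Lemma expgzDn g m (k : nat) : expgz g (m + k%:Z)%R = expgz g m * g ^+ k.
Proof.
elim: k => [|k IH] in m *; first by rewrite addr0 mulg1.
have -> : (m + k.+1%:Z = (m + 1) + k%:Z)%R by lia.
rewrite IH expgS mulgA; congr (_ * _).
case: m => [m|[|m]].
- have -> : (Posz m + 1 = Posz m.+1)%R by lia.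
  by rewrite /= expgSr.
- by rewrite /= mulVg.
have -> : (Negz m.+1 + 1 = Negz m)%R by lia.
by rewrite /= [g ^+ m.+2]expgS invgM mulgVK.
Qed.

Lemma expgzD g m n : expgz g (m + n)%R = expgz g m * expgz g n.
Proof.
case: (lerP 0%R n) => [n0|n0].
  have -> : n = (`|n|%N%:Z)%R by lia.
  exact: expgzDn.
have [k ->] : exists k, n = (- k%:Z)%R by exists `|n|%N; lia.
by rewrite expgzN /= -[m in RHS](subrK k%:Z%R) expgzDn mulgK.
Qed.

End IntegerPowers.

(** * Atom length in an atomic monoid *)

Section AtomNorm.
Set Implicit Arguments.
Unset Strict Implicit.
Import Order.TTheory GRing.Theory Num.Theory.
Variable M : monoidType.
Hypothesis atomicM : atomic M.
Implicit Types (a b c : M).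

Lemma atom_norm_ge a n : atom_lengths a n -> (n <= atom_norm a)%N.
Proof.
move=> an; rewrite -leEnat; apply: ge_supremum_Nmem => //.
exact/nat_supremums_neq0/atomicM.2.
Qed.

Lemma atom_normP a : atom_lengths a (atom_norm a).
Proof.
have [s sA sa] := atomicM.1 a.
have [ub ubP] := atomicM.2 a.
have ex : exists n, `[< atom_lengths a n >].
  by exists (size s); apply/asboolP; exists s.
have bd n : `[< atom_lengths a n >] -> (n <= ub)%N by move=> /asboolP /ubP.
case: (ex_maxnP ex bd) => m /asboolP am maxm.
suff <- : m = atom_norm a by [].
apply/eqP; rewrite eqn_leq atom_norm_ge //=.
rewrite -leEnat /atom_norm /supremum ifF; last first.
  by apply/negbTE/set0P; exists m.
case: xgetP => [y _ [_ lby]|nex].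
  by apply: lby => n an; rewrite leEnat; apply: maxm; apply/asboolP.
have : ubound (atom_lengths a) !=set0 by exists ub.
by move=> /nat_supremums_neq0[y /nex].
Qed.

(** A longest atom word of [a] followed by any atom word of [c], which is nonempty, spells
    [a * c]. *)
Lemma atom_norm_lt a c : c <> 1 -> (atom_norm a < atom_norm (a * c))%N.
Proof.
move=> c1.
have [sa [sA sa_a] size_a] := atom_normP a.
have [sc sC sc_c] := atomicM.1 c.
have sc0 : (0 < size sc)%N.
  by case: sc sC sc_c => // _ e; case: c1; rewrite -e big_nil.
apply: (@leq_trans (size (sa ++ sc))).
  by rewrite size_cat size_a -addn1 leq_add2l.
apply: atom_norm_ge; exists (sa ++ sc) => //; split.
  by move=> x; rewrite mem_cat => /orP[/sA|/sC].
by rewrite big_cat /= sa_a sc_c.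
Qed.

End AtomNorm.

(** * The left order on the group of fractions and the powers of Delta *)

Section GarsideOrder.
Set Implicit Arguments.
Unset Strict Implicit.
Import Order.TTheory GRing.Theory Num.Theory.
Variables (M : monoidType) (G : groupType).
Variables (iota : UMagmaMorphism.type M G) (Delta : M).
Hypothesis hM : garside_monoid Delta.
Hypothesis hG : group_of_fractions iota.
Hypothesis Delta1 : Delta <> 1.
Implicit Types (x y z u g h : G) (a b c : M) (r : int).

Notation le := (leG iota).
Notation D := (expgz (iota Delta)).

Let iota1 : iota 1 = 1 := gmulf1.
Let iotaM : {morph iota : a b / a * b} := gmulfM.

Lemma leGP x y : le x y <-> exists c, x * iota c = y.
Proof.
split=> [[_ [c _ <-] <-]|[c <-]]; first by exists c.
by exists (iota c) => //; exists c.
Qed.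

Lemma leG_mulr x c : le x (x * iota c).
Proof. by apply/leGP; exists c. Qed.

Lemma leG_refl x : le x x.
Proof. by rewrite -{2}[x]mulg1 -iota1; apply: leG_mulr. Qed.

Lemma leG_trans y x z : le x y -> le y z -> le x z.
Proof.
move=> /leGP[a <-] /leGP[b <-]; rewrite -mulgA -iotaM; exact: leG_mulr.
Qed.

Lemma leG_mul2l z x y : le (z * x) (z * y) <-> le x y.
Proof.
split=> /leGP[c e]; apply/leGP; exists c; last by rewrite -mulgA e.
by apply: (mulgI z); rewrite mulgA.
Qed.

Lemma mul_eq1 a c : a * c = 1 -> a = 1.
Proof.
move=> ac1; have [_ anti _ _ _] := garside_latticeL hM.
by apply: anti; [exists c|exists a; rewrite mul1g].
Qed.

Lemma leG_anti x y : le x y -> le y x -> x = y.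
Proof.
move=> /leGP[a <-] /leGP[b].
rewrite -mulgA -iotaM -{2}[x]mulg1 => /mulgI; rewrite -iota1.
by move=> /hG.1 /mul_eq1 ->; rewrite iota1 mulg1.
Qed.

Lemma D1 : D 1%R = iota Delta. Proof. by rewrite /= expg1. Qed.

Lemma D0 : D 0%R = 1. Proof. by []. Qed.

(** For a simple [x] with [x * b' = Delta], the right divisor [b'] of [Delta] is also a left
    divisor, [b' * c = Delta], so [x * Delta = x * b' * c = Delta * c]. Induction on a word in
    simples does the rest. *)
Lemma Delta_commute a : exists b, a * Delta = Delta * b.
Proof.
have [simpleLR simpleG] := garside_delta hM.
have [s sD <-] := simpleG a.
elim: s sD => [_|x s IH sD].
  by exists 1; rewrite big_nil mul1g mulg1.
have [y sy|b sb] := IH; first by apply: sD; rewrite inE sy orbT.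
have [b' xb'] := sD x (mem_head _ _).
have [c b'c] : leL b' Delta by apply/simpleLR; exists x.
by exists (c * b); rewrite big_cons -mulgA sb mulgA -{1}b'c mulgA xb' mulgA.
Qed.

Lemma Delta_commuteV a : exists b, Delta * a = b * Delta.
Proof.
have [simpleLR simpleG] := garside_delta hM.
have [s sD <-] := simpleG a.
elim: s sD => [_|x s IH sD].
  by exists 1; rewrite big_nil mul1g mulg1.
have [y sy|b sb] := IH; first by apply: sD; rewrite inE sy orbT.
have [b' xb'] : leR x Delta by apply/simpleLR/sD/mem_head.
have [c b'c] : leR b' Delta by apply/simpleLR; exists x.
by exists (c * b); rewrite big_cons mulgA -{1}b'c -(mulgA c) xb' -!mulgA sb.
Qed.

(** Makes right multiplication by [D r] monotone for an order that is by definition invariant only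
    under left multiplication. *)
Lemma D_commute r a : exists b, iota a * D r = D r * iota b.
Proof.
have nat_case (k : nat) c : exists b, iota c * iota Delta ^+ k = iota Delta ^+ k * iota b.
  elim: k c => [|k IH] c; first by exists c; rewrite mulg1 mul1g.
  have [b cb] := Delta_commute c; have [b' bb'] := IH b.
  by exists b'; rewrite expgS mulgA -iotaM cb iotaM -mulgA bb' mulgA.
have neg_case (k : nat) c : exists b, iota c * iota Delta ^- k = iota Delta ^- k * iota b.
  elim: k c => [|k IH] c; first by exists c; rewrite invg1 mulg1 mul1g.
  have [b cb] := Delta_commuteV c; have [b' bb'] := IH b.
  exists b'; rewrite expgSr invgM -mulgA -bb' !mulgA; congr (_ * _).
  by apply: (mulgI (iota Delta)); rewrite mulgA -iotaM cb iotaM mulgK mulVKg.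
by case: r => k; [exact: nat_case|exact: neg_case].
Qed.

Lemma leG_mulDr r x y : le x y -> le (x * D r) (y * D r).
Proof.
move=> /leGP[a <-]; have [b ab] := D_commute r a.
by rewrite -mulgA ab mulgA; apply: leG_mulr.
Qed.

Lemma leG_mul2D r x y : le (x * D r) (y * D r) <-> le x y.
Proof.
split=> [/(leG_mulDr (- r)%R)|]; last exact: leG_mulDr.
by rewrite -!mulgA -!expgzD subrr D0 !mulg1.
Qed.

Lemma leG_xD x r : (0 <= r)%R -> le x (x * D r).
Proof. by case: r => // k _; rewrite /= -gmulfXn; apply: leG_mulr. Qed.

Lemma leG_DD r (s : int) : le (D r) (D s) <-> (r <= s)%R.
Proof.
split=> [leDD|lers]; last first.
  have -> : (s = r + (s - r))%R by lia.
  by rewrite expgzD; apply: leG_xD; lia.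
(* If [s < r], then [D (s + 1) <= D r <= D s <= D (s + 1)], which forces [Delta = 1]. *)
case: lerP => // lt_sr; case: Delta1.
have : le (D (s + 1)%R) (D s).
  apply: leG_trans leDD; have -> : (r = (s + 1) + (r - s - 1))%R by lia.
  by rewrite (expgzD _ (s + 1)%R); apply: leG_xD; lia.
move=> leS; have := leG_anti leS; rewrite expgzD.
move=> /(_ (@leG_xD (D s) 1%R isT)); rewrite -{2}[D s]mulg1 => /mulgI.
by rewrite D1 -iota1 => /hG.1.
Qed.

(** Inversion turns lower bounds by powers of Delta into upper bounds, so every fact on sup will
    follow from one on inf. *)
Lemma leG_invD x r : le (D r) x <-> le x^-1 (D (- r)%R).
Proof.
rewrite -(leG_mul2l x x^-1) mulgV -(leG_mul2D r 1).
by rewrite mul1g -mulgA -expgzD addNr D0 mulg1.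
Qed.

Lemma leG_Dinv x r : le x (D r) <-> le (D (- r)%R) x^-1.
Proof. by rewrite leG_invD invgK opprK. Qed.

Lemma positive_bound a : exists n : nat, le (iota a) (D n).
Proof.
have [_ simpleG] := garside_delta hM.
have [s sD <-] := simpleG a; exists (size s).
elim: s sD => [_|x s IH sD]; first by rewrite big_nil iota1; apply: leG_refl.
rewrite big_cons iotaM.
have /leG_mul2l-/(_ (iota x)) : le (iota (\prod_(j <- s) j)) (D (size s)).
  by apply: IH => y sy; apply: sD; rewrite inE sy orbT.
move=> /leG_trans; apply.
have [b xb] := sD x (mem_head _ _).
have -> : (Posz (size (x :: s)) = 1 + Posz (size s))%R by [].
rewrite expgzD D1; apply: leG_mulDr.
by rewrite -xb iotaM; apply: leG_mulr.
Qed.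

Lemma G_bound x : exists n : nat, le (D (- n%:Z)%R) x /\ le x (D n).
Proof.
have [a [b ->]] := hG.2 x.
have [n an] := positive_bound a; have [m bm] := positive_bound b.
have div_le c d : le (iota c / iota d) (iota c).
  by rewrite -{2}[iota c](mulgVK (iota d)); apply: leG_mulr.
exists (n + m)%N; split.
  apply/leG_invD; rewrite invgF opprK.
  apply: leG_trans (leG_trans (div_le b a) bm) _.
  by apply/leG_DD; lia.
apply: leG_trans (leG_trans (div_le a b) an) _.
by apply/leG_DD; lia.
Qed.

(** * Finite joins in the group *)

Lemma leG_join2 x y :
  exists j, [/\ le x j, le y j & forall z, le x z -> le y z -> le j z].
Proof.
have [n [nx _]] := G_bound x; have [m [my _]] := G_bound y.
(* A power of Delta below both [x] and [y]: after left division by it, the join is taken in the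
   monoid. *)
pose k := D (- (n + m)%:Z)%R.
have lek z p : (- (n + m)%:Z <= p)%R -> le (D p) z -> exists c, z = k * iota c.
  move=> le_p /(leG_trans (proj2 (leG_DD _ _) le_p)).
  by move=> /leGP[c <-]; exists c.
have [|a ->] := lek _ _ _ nx; first by lia.
have [|b ->] := lek _ _ _ my; first by lia.
have [_ _ _ _ /(_ a b)[j [[a' aj] [b' bj] jmin]]] := garside_latticeL hM.
exists (k * iota j); split.
- by apply/leG_mul2l; rewrite -aj iotaM; apply: leG_mulr.
- by apply/leG_mul2l; rewrite -bj iotaM; apply: leG_mulr.
move=> z /leGP[c <-] /leGP[d].
rewrite -!mulgA -!iotaM => /mulgI /hG.1 bd.
have [e <-] := jmin (a * c) (ex_intro _ c erefl) (ex_intro _ d bd).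
by apply/leG_mul2l; rewrite iotaM; apply: leG_mulr.
Qed.

Lemma leG_join (F : nat -> G) k : (0 < k)%N ->
  exists j, (forall n, (n < k)%N -> le (F n) j) /\
    forall z, (forall n, (n < k)%N -> le (F n) z) -> le j z.
Proof.
case: k => // k _; elim: k => [|k [j [Fj jmin]]].
  exists (F 0); split=> [[|n] // _|z]; [exact: leG_refl|exact].
have [j' [jj' Fj' j'min]] := leG_join2 j (F k.+1).
exists j'; split=> [n|z Fz].
  rewrite ltnS leq_eqVlt => /orP[/eqP -> //|ltnk].
  exact: leG_trans (Fj n ltnk) jj'.
by apply: j'min; [apply: jmin => n nk; apply: Fz; apply: ltnW|exact: Fz].
Qed.

(** * Growth of inf along powers, up to conjugacy *)

Lemma leG_expg x r n : le (D r) x -> le (D (n%:Z * r)%R) (x ^+ n).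
Proof.
move=> rx; elim: n => [|n IH]; first by rewrite mul0r; apply: leG_refl.
have -> : (n.+1%:Z * r = r + n%:Z * r)%R by lia.
rewrite expgzD expgS; apply: leG_trans (leG_mulDr _ rx) _.
exact/leG_mul2l.
Qed.

(** The relation [x >= r] of the overview; it will mean that [inf_s] of [x] is at least [r]. *)
Definition raises x r : Prop := exists u, le (D r) (x ^ u).

Lemma raises_expg x r n : raises x r -> raises (x ^+ n) (n%:Z * r)%R.
Proof. by move=> [u xu]; exists u; rewrite conjXg; apply: leG_expg. Qed.

Lemma leG_conj x u r : le (D r) (x ^ u) <-> le (u * D r) (x * u).
Proof. by rewrite -(leG_mul2l u) conjgE mulVKg. Qed.

Lemma raises_max x : exists2 p, raises x p & ubound (raises x) p.
Proof.
have [s [sx xs]] := G_bound x; apply: (@int_set_max _ (- s%:Z)%R s).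
  by exists 1; rewrite conjg1.
move=> r /= [u /leG_conj xu]; rewrite leNgt; apply/negP => lt_sr.
have [c [cu uc]] := G_bound u.
(* The bounds below give [n * (r - s) <= 2 * c], which this [n] contradicts when [s < r]. *)
pose n := (2 * c).+1.
have xnu : le (u * D (n%:Z * r)%R) (x ^+ n * u).
  by apply/leG_conj; rewrite conjXg; apply/leG_expg/leG_conj.
have xn : le (x ^+ n) (D (n%:Z * s%:Z)%R).
  move/leG_Dinv: xs => /leG_expg-/(_ n); rewrite expVgn.
  by have -> : (n%:Z * - s%:Z = - (n%:Z * s%:Z))%R; [lia|move/leG_Dinv].
have lower : le (D (- c%:Z + n%:Z * r)%R) (x ^+ n * u).
  apply: leG_trans xnu; rewrite expgzD; exact: leG_mulDr.
have upper : le (x ^+ n * u) (D (n%:Z * s%:Z + c%:Z)%R).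
  apply: (@leG_trans (x ^+ n * D c)); first by apply/leG_mul2l.
  by rewrite expgzD; apply: leG_mulDr.
by have /leG_DD := leG_trans lower upper; rewrite /n; nia.
Qed.

(* [X i] is the join of the [g ^ n u Delta ^ - m] with [n < k] and
   [n b - m k < i + k]; for given [n], the least such [m] suffices. *)
Lemma slope_chain g u (k : nat) (b : int) :
    (0 < k)%N -> le (u * D b) (g ^+ k * u) ->
  exists X : int -> G, [/\ forall i j : int, (i <= j)%R -> le (X i) (X j),
    forall i : int, X (i + k%:Z)%R = X i * D 1%R
    & forall i : int, le (X (i + b)%R) (g * X i)].
Proof.
move=> k0 gk.
have kZ0 : (k%:Z != 0)%R by lia.
pose F (i : int) (n : nat) := g ^+ n * u * D (- ((n%:Z * b - i) %/ k%:Z)%Z)%R.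
have [X XP] := choice (fun i => leG_join (F i) k0).
have FX i n : (n < k)%N -> le (F i n) (X i) by move: n; have [] := XP i.
have Xmin i z : (forall n, (n < k)%N -> le (F i n) z) -> le (X i) z.
  by have [_] := XP i; apply.
have Fper i n : F (i + k%:Z)%R n = F i n * D 1%R.
  rewrite /F -[RHS]mulgA -expgzD; congr (_ * D _).
  have -> : (n%:Z * b - (i + k%:Z) = (- 1) * k%:Z + (n%:Z * b - i))%R by lia.
  by rewrite divzMDl //; lia.
exists X; split.
- move=> i j ij; apply: Xmin => n nk; apply: leG_trans (FX j n nk).
  apply/leG_mul2l/leG_DD; rewrite lerN2 lez_divRL; last by lia.
  by apply: le_trans (lez_floor _ kZ0) _; lia.
- move=> i; apply: leG_anti; first apply: Xmin => n nk.
    by rewrite Fper; apply/leG_mulDr/FX.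
  rewrite -(leG_mul2D (- 1)%R) -mulgA -expgzD subrr D0 mulg1.
  apply: Xmin => n nk; apply/(leG_mul2D 1%R).
  by rewrite -Fper -mulgA -expgzD addNr D0 mulg1; apply: FX.
(* Left multiplication by [g] turns [F i n] into [F (i + b) n.+1]. *)
move=> i; apply: Xmin => -[|n] nk; last first.
  have : le (g * F i n) (g * X i) by apply/leG_mul2l/FX/ltnW.
  rewrite /F !mulgA -expgS; congr (le (_ * D _) _); congr (- (_ %/ _)%Z)%R; lia.
(* The remaining term [F (i + b) 0] is compared with [g * F i k.-1], in which [g ^+ k * u] appears;
   [gk] enters here. *)
have : le (g * F i k.-1) (g * X i) by apply/leG_mul2l/FX; rewrite prednK.
apply: leG_trans; rewrite /F !mulgA -expgS prednK // mul1g.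
have -> : (k.-1%:Z = k%:Z - 1)%R by lia.
have -> : ((k%:Z - 1) * b - i = b * k%:Z + (0%:Z * b - (i + b)))%R by lia.
rewrite divzMDl // (opprD b) expgzD mulgA; apply: leG_mulDr.
apply/(leG_mul2D b); rewrite -[X in le _ X]mulgA -expgzD addNr D0 mulg1; exact: gk.
Qed.

(** Pigeonhole on jump positions modulo [k]: over one period the chain climbs by [Delta] and each
    jump costs at least one atom, so at most [atom_norm Delta] residues are jumps. *)
Lemma chain_cycle g (X : int -> G) (k : nat) (b : int) : (0 < k)%N ->
    (forall i j : int, (i <= j)%R -> le (X i) (X j)) ->
    (forall i : int, X (i + k%:Z)%R = X i * D 1%R) ->
    (forall i : int, le (X (i + b)%R) (g * X i)) ->
  exists (q : nat) (p i : int), [/\ (0 < q <= atom_norm Delta)%N,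
    (q%:Z * b <= p * k%:Z)%R & le (X i * D p) (g ^+ q * X i)].
Proof.
move=> k0 mono per step.
have kZ0 : (k%:Z != 0)%R by lia.
have perZ (i m : int) : X (i + m * k%:Z)%R = X i * D m.
  have pern (j : int) (n : nat) : X (j + n%:Z * k%:Z)%R = X j * D n.
    elim: n => [|n IH]; first by rewrite mul0r addr0 mulg1.
    have -> : (j + n.+1%:Z * k%:Z = j + n%:Z * k%:Z + k%:Z)%R by lia.
    have -> : (Posz n.+1 = n%:Z + 1)%R by lia.
    by rewrite per IH expgzD mulgA.
  case: (lerP 0%R m) => m0.
    by have -> : m = (`|m|%N%:Z)%R by lia.
  have [n ->] : exists n : nat, m = (- n%:Z)%R by exists `|m|%N; lia.
  rewrite -[X i in RHS](_ : X (i + - n%:Z * k%:Z + n%:Z * k%:Z) = _)%R.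
    by rewrite pern -mulgA -expgzD subrr D0 mulg1.
  by congr X; lia.
have XD i : X i * D 1%R <> X i.
  rewrite -{2}[X i]mulg1 => /mulgI; rewrite -D0 => e.
  have : le (D 1%R) (D 0%R) by rewrite e; apply: leG_refl.
  by move/leG_DD.
pose jump (i : int) := X i <> X (i + 1)%R.
(* A jump occurs within a period, since otherwise [X i * D 1] would equal [X i]. *)
have ex_next (i : int) : exists j : int, [/\ (i <= j)%R, X j = X i & jump j].
  have ex : exists n : nat, `[< jump (i + n%:Z)%R >].
    apply: contrapT => noex; apply: (XD i); rewrite -per.
    elim: k {k0 kZ0 per perZ} => [|k IH]; first by rewrite addr0.
    rewrite -IH; have -> : (i + k.+1%:Z = i + k%:Z + 1)%R by lia.
    by apply: contrapT => e; apply: noex; exists k; apply/asboolP => /esym.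
  case: (ex_minnP ex) => n /asboolP jn minn.
  exists (i + n%:Z)%R; split=> //; first by lia.
  elim: n minn {jn} => [|n IH] minn; first by rewrite addr0.
  rewrite -IH => [|m /minn]; last by lia.
  have -> : (i + n.+1%:Z = i + n%:Z + 1)%R by lia.
  apply: contrapT => e; suff : (n.+1 <= n)%N by rewrite ltnn.
  by apply: minn; apply/asboolP => /esym.
have [next nextP] := choice ex_next.
(* Successive jumps: from each one, shift by [b] and move to the next jump. The shift costs one
   factor [g], the move leaves [X] unchanged. *)
pose js s := iter s (fun i => next (i + b)%R) (next 0%R).
have jump_js s : jump (js s).
  by case: s => [|s]; [have [] := nextP 0%R|have [] := nextP (js s + b)%R].
have js_ge (r s : nat) : (js r + s%:Z * b <= js (s + r)%N)%R.
  elim: s => [|s IH]; first by rewrite add0n mul0r addr0.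
  by have [] := nextP (js (s + r)%N + b)%R; rewrite addSn /=; lia.
have js_le (r s : nat) : le (X (js (s + r)%N)) (g ^+ s * X (js r)).
  elim: s => [|s IH]; first by rewrite mul1g; apply: leG_refl.
  rewrite addSn /=; have [_ -> _] := nextP (js (s + r)%N + b)%R.
  by apply: leG_trans (step _) _; rewrite expgS -mulgA; apply/leG_mul2l.
pose res s : int := (js s %% k%:Z)%Z.
have js_res s : js s = (res s + (js s %/ k%:Z)%Z * k%:Z)%R.
  by rewrite /res addrC -divz_eq.
have res_ge0 s : (0 <= res s)%R by apply: modz_ge0.
have res_ltk s : (res s < k%:Z)%R by apply: ltz_pmod; lia.
have jump_res s : jump (res s).
  move=> e; apply: (jump_js s); rewrite js_res.
  rewrite [(res s + _ + 1)%R](_ : _ = res s + 1 + (js s %/ k%:Z)%Z * k%:Z)%R.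
    by rewrite !perZ e.
  by lia.
(* The positive quotient of [X i] by [X 0]; the value at negative [i] is a dummy. Its atom length
   [psi] increases strictly past each jump and reaches [atom_norm Delta] at [k]. *)
have ex_quo i : exists a, (0 <= i)%R -> X 0%R * iota a = X i.
  case: (lerP 0%R i) => i0; last by exists 1.
  by have /leGP[a] := mono _ _ i0; exists a.
have [quo quoP] := choice ex_quo.
pose psi i := atom_norm (quo i).
have psi_lt i j : (0 <= i)%R -> (i < j)%R -> jump i -> (psi i < psi j)%N.
  move=> i0 ij ji.
  have /leGP[c ic] := mono _ _ (ltW ij).
  have -> : psi j = atom_norm (quo i * c).
    congr atom_norm; apply: hG.1; apply: (mulgI (X 0%R)).
    by rewrite iotaM mulgA !quoP ?ic //; lia.
  apply: (atom_norm_lt (garside_atomic hM)) => c1; apply: ji.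
  apply: leG_anti; first by apply: mono; lia.
  by rewrite -[X i]mulg1 -iota1 -c1 ic; apply: mono; lia.
have psi_ltN s : (psi (res s) < atom_norm Delta)%N.
  have <- : psi k = atom_norm Delta; last by apply: psi_lt.
  congr atom_norm; apply: hG.1; apply: (mulgI (X 0%R)).
  by rewrite quoP // -[Posz k]add0r per D1.
have psi_inj s t : psi (res s) = psi (res t) -> res s = res t.
  move=> e; case: (ltgtP (res s) (res t)) => // lt_res.
    by have := psi_lt _ _ (res_ge0 s) lt_res (jump_res s); rewrite e ltnn.
  by have := psi_lt _ _ (res_ge0 t) lt_res (jump_res t); rewrite e ltnn.
(* [N + 1] indices with only [N] possible values of [psi], where [N = atom_norm Delta]: two of the
   jumps agree modulo [k]. *)
pose f (s : 'I_(atom_norm Delta).+1) := Ordinal (psi_ltN s).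
have [s [t [lt_st tN e]]] : exists s t, [/\ (s < t)%N, (t <= atom_norm Delta)%N
    & res s = res t].
  have /injectivePn[s [t st /(congr1 val) /= /psi_inj e]] : ~~ injectiveb f.
    apply/negP => /injectiveP /leq_card.
    by rewrite !card_ord ltnn.
  case: (ltngtP s t) => [lt_st|lt_ts|/val_inj e'].
  - by exists s, t; split=> //; rewrite -ltnS.
  - by exists t, s; split=> //; rewrite -ltnS.
  - by rewrite e' eqxx in st.
have js_ts : js t = (js s + ((js t %/ k%:Z)%Z - (js s %/ k%:Z)%Z) * k%:Z)%R.
  by rewrite {1}js_res {1}(js_res s) e; lia.
(* [q] counts the moves between the two jumps and [p] the periods travelled; each move advances by
   at least [b], hence [q * b <= p * k]. *)
exists (t - s)%N, ((js t %/ k%:Z)%Z - (js s %/ k%:Z)%Z)%R, (js s).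
split; first by lia.
  by have := js_ge s (t - s)%N; rewrite subnK; [lia|exact: ltnW].
by rewrite -perZ -js_ts; have := js_le s (t - s)%N; rewrite subnK // ltnW.
Qed.

(** Any rate [b / k] is matched or exceeded by a power with bounded exponent; the conjugator is the
    chain element at which the cycle closes. *)
Lemma raises_root g (k : nat) (b : int) : (0 < k)%N -> raises (g ^+ k) b ->
  exists (q : nat) (p : int), [/\ (0 < q <= atom_norm Delta)%N,
    (q%:Z * b <= p * k%:Z)%R & raises (g ^+ q) p].
Proof.
move=> k0 [u /leG_conj gu].
have [X [mono per step]] := slope_chain k0 gu.
have [q [p [i [qN qp gX]]]] := chain_cycle k0 mono per step.
by exists q, p; split=> //; exists (X i); apply/leG_conj.
Qed.

(* [p / q] is the limit of [inf (g ^ k) / k]. *)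
Lemma raises_slope g : exists (q : nat) (p : int),
  [/\ (0 < q <= atom_norm Delta)%N, raises (g ^+ q) p
    & forall (k : nat) (b : int), (0 < k)%N -> raises (g ^+ k) b ->
        (q%:Z * b <= p * k%:Z)%R].
Proof.
have [p pP pmax] := all_sig2 (fun q => cid2 (raises_max (g ^+ q))).
(* Used only to see that [atom_norm Delta] is positive, so that the maximum below ranges over a
   nonempty type. *)
have [q0 [_ [qN _ _]]] : exists q p, [/\ (0 < q <= atom_norm Delta)%N,
    (q%:Z * p <= p * q%:Z)%R & raises (g ^+ q) p].
  have [r gr] := raises_max (g ^+ 1).
  by have [q [p' [? ? ?]]] := raises_root (ltn0Sn 0) gr; exists q, p'; split=> //; lia.
have N0 : (q0.-1 < atom_norm Delta)%N by lia.
(* Best rate of each exponent from 1 to [atom_norm Delta]; by [raises_root] the largest of them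
   bounds the rates of all exponents. *)
pose slope (i : 'I_(atom_norm Delta)) : rat := ((p i.+1)%:~R / i.+1%:R)%R.
case: (@arg_maxP _ _ _ (Ordinal N0) xpredT slope) => // i _ imax.
exists i.+1, (p i.+1); split; [exact: ltn_ord|exact: pP|].
move=> k b k0 /(raises_root k0)[q [p' [qN' qp' gp']]].
have q'N : (q.-1 < atom_norm Delta)%N by lia.
have := imax (Ordinal q'N) isT; rewrite /slope /= prednK; last by lia.
rewrite ler_pdivrMr ?ltr0n //; last by lia.
rewrite mulrAC ler_pdivlMr ?ltr0n // !pmulrn -!intrM ler_int => le_slope.
have le_p' := pmax q p' gp'.
have q0' : (0 < q%:Z)%R by lia.
rewrite -(ler_pM2l q0').
apply: (@le_trans _ _ (i.+1%:Z * (p q * k%:Z))%R).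
  rewrite mulrCA ler_pM2l //; apply: le_trans qp' _.
  by rewrite ler_pM2r.
by rewrite !mulrA ler_pM2r // mulrC [(q%:Z * _)%R]mulrC.
Qed.

(** * inf, sup and their summit values *)

Lemma inf_GE h p :
  le (D p) h -> (forall r, le (D r) h -> (r <= p)%R) -> inf_G iota Delta h = p.
Proof. by move=> ph pmax; apply: maximumE. Qed.

Lemma inf_GP h : le (D (inf_G iota Delta h)) h /\
  forall r, le (D r) h -> (r <= inf_G iota Delta h)%R.
Proof.
have [n [nh hn]] := G_bound h.
have ub r : le (D r) h -> (r <= n%:Z)%R by move=> rh; apply/leG_DD/(leG_trans rh).
have [p ph pmax] := int_set_max (A := [set r | le (D r) h]) nh ub.
by rewrite (inf_GE ph pmax).
Qed.

Lemma sup_GE h : sup_G iota Delta h = (- inf_G iota Delta h^-1)%R.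
Proof.
have [infh maxh] := inf_GP h^-1.
apply: minimumE => [|r /= /leG_Dinv/maxh]; last by lia.
by rewrite /=; apply/leG_Dinv; rewrite opprK.
Qed.

Lemma inf_sE g p : raises g p -> ubound (raises g) p -> inf_s iota Delta g = p.
Proof.
move=> [u pu] pmax; apply: maximumE => [|_ /= [_ [v _ <-] <-]]; last first.
  by apply: pmax; exists v; have [] := inf_GP (g ^ v).
exists (g ^ u); first by exists u.
by apply: inf_GE => // r ru; apply: pmax; exists u.
Qed.

Lemma sup_sE g : sup_s iota Delta g = (- inf_s iota Delta g^-1)%R.
Proof.
have [p [u pu] pmax] := raises_max g^-1.
rewrite (inf_sE (ex_intro _ u pu) pmax).
apply: minimumE => [|_ /= [_ [v _ <-] <-]]; last first.
  rewrite sup_GE lerN2; apply: pmax; exists v; rewrite conjVg.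
  by have [] := inf_GP (g ^ v)^-1.
exists (g ^ u); first by exists u.
rewrite sup_GE -conjVg; congr (- _)%R.
by apply: inf_GE => // r ru; apply: pmax; exists u.
Qed.

(** * Word length over the simple elements *)

Lemma leG_mulD x y p r : le x (D p) -> le y (D r) -> le (x * y) (D (p + r)%R).
Proof.
move=> xp yr; apply: (@leG_trans (x * D r)); first exact/leG_mul2l.
by rewrite expgzD; apply: leG_mulDr.
Qed.

Lemma leG_Dmul x y p r : le (D p) x -> le (D r) y -> le (D (p + r)%R) (x * y).
Proof.
move=> px ry; apply: (@leG_trans (x * D r)); last exact/leG_mul2l.
by rewrite expgzD; apply: leG_mulDr.
Qed.

Lemma simplesP d : simples iota Delta d <-> le 1 d /\ le d (D 1%R).
Proof.
split=> [[a [c ac] <-]|[/leGP[a <-] /leGP[c]]].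
  split; first by apply/leGP; exists a; rewrite mul1g.
  by rewrite D1 -ac iotaM; apply: leG_mulr.
by rewrite mul1g D1 -iotaM => /hG.1 ac; exists a => //; exists c.
Qed.

Notation letters := (simples iota Delta `|` [set x^-1 | x in simples iota Delta]).

(** Here [n] counts letters taken as simples and [m] letters taken as inverses of simples. *)
Lemma word_bounds (w : seq G) : word_over letters w ->
  exists m n : nat, [/\ size w = (m + n)%N,
    le (D (- m%:Z)%R) (\prod_(x <- w) x) & le (\prod_(x <- w) x) (D n)].
Proof.
elim: w => [_|x w IH wA].
  by exists 0, 0; rewrite big_nil; split=> //; apply: leG_refl.
have [y yw|m [n [wmn mw wn]]] := IH; first by apply: wA; rewrite inE yw orbT.
rewrite big_cons /= wmn.
have [/simplesP[x1 xD]|[y /simplesP[y1 yD] <-]] := wA x (mem_head _ _).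
  exists m, n.+1; split; first by rewrite addnS.
    by rewrite -[(- _)%R]add0r; apply: leG_Dmul.
  exact: (@leG_mulD _ _ 1%R n).
exists m.+1, n; split; first by rewrite addSn.
  have -> : (- m.+1%:Z = - 1 + - m%:Z)%R by lia.
  apply: leG_Dmul => //.
  exact/leG_Dinv.
by apply: (@leG_mulD _ _ 0%R n) => //; rewrite -oppr0; apply/leG_invD.
Qed.

Lemma positive_word (n : nat) x : le 1 x -> le x (D n) ->
  exists w, [/\ word_over (simples iota Delta) w, size w = n
    & \prod_(y <- w) y = x].
Proof.
elim: n x => [|n IH] x x1 xn.
  by exists [::]; split=> //; rewrite big_nil; apply: leG_anti.
(* [e^-1] is the largest simple right divisor of [x]; it becomes the last letter. *)
have [e [xe De emin]] := leG_join2 x^-1 (D (- 1)%R).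
have [||w [wD wn wx]] := IH (x * e).
- by rewrite -[1](mulgV x); apply/leG_mul2l.
- rewrite -(leG_mul2l x^-1) mulKg; apply: emin.
    by rewrite -{1}[x^-1]mulg1; apply/leG_mul2l; rewrite -D0; apply/leG_DD; lia.
  rewrite -(leG_mul2D (- n%:Z)%R) -mulgA -!expgzD subrr D0 mulg1.
  have -> : (- 1 - n%:Z = - n.+1%:Z)%R by lia.
  exact/leG_Dinv.
exists (rcons w e^-1); split; last 1 first.
- by rewrite -cats1 big_cat big_seq1 /= wx mulgK.
- move=> y; rewrite mem_rcons inE => /orP[/eqP ->|/wD //].
  apply/simplesP; split; last by apply/leG_Dinv; rewrite invgK.
  rewrite -D0 -oppr0; apply/leG_Dinv/emin; last exact/leG_DD.
  by rewrite -oppr0; apply/leG_invD.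
- by rewrite size_rcons wn.
Qed.

Lemma word_of_bounds (m n : nat) x : le (D (- m%:Z)%R) x -> le x (D n) ->
  exists w, [/\ word_over letters w, size w = (m + n)%N & \prod_(y <- w) y = x].
Proof.
(* Write [x] as the fraction of [x * e], which lies between 1 and [D n], by [e], which lies between
   1 and [D m]. *)
move=> mx xn; have [e [xe e1 emin]] := leG_join2 x^-1 1.
have [||w [wD wn wx]] := @positive_word n (x * e).
- by rewrite -[1](mulgV x); apply/leG_mul2l.
- rewrite -(leG_mul2l x^-1) mulKg; apply: emin.
    by rewrite -{1}[x^-1]mulg1; apply/leG_mul2l; rewrite -D0; apply/leG_DD.
  by rewrite -(leG_mul2l x) mulg1 mulVKg.
have [//||v [vD vm ve]] := @positive_word m e.
  apply: emin; last by rewrite -D0; apply/leG_DD.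
  by rewrite -[Posz m]opprK; apply/leG_invD.
exists (w ++ [seq y^-1 | y <- rev v]); split.
- move=> y; rewrite mem_cat => /orP[/wD|/mapP[z]]; first by left.
  by rewrite mem_rev => /vD vz ->; right; exists z.
- by rewrite size_cat size_map size_rev wn vm addnC.
by rewrite big_cat big_map /= prodgV revK wx ve mulgK.
Qed.

(** A word with [m] inverse and [n] simple letters exists exactly when [D (- m) <= x <= D n], and
    [m] and [n] can be minimised independently. *)
Lemma word_lengthE x : word_length (simples iota Delta) x =
  (`|Num.max 0%R (- inf_G iota Delta x)%R| +
   `|Num.max 0%R (sup_G iota Delta x)|)%N.
Proof.
have [infx infmax] := inf_GP x.
have [infV infVmax] := inf_GP x^-1.
apply: minimumE => [|_ /= [w [wD wx] <-]].
  have [||w [wD wn wx]] := @word_of_bounds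
      `|Num.max 0%R (- inf_G iota Delta x)%R|%N
      `|Num.max 0%R (sup_G iota Delta x)|%N x.
  - by apply: leG_trans infx; apply/leG_DD; lia.
  - apply/leG_Dinv; apply: leG_trans infV; apply/leG_DD; rewrite sup_GE; lia.
  by exists w.
have [m [n [-> mw wn]]] := word_bounds wD.
rewrite wx in mw wn; have := infmax _ mw.
by move/leG_Dinv: wn => /infVmax; rewrite leEnat sup_GE; lia.
Qed.

(** * Linearity of inf and sup, and periodic geodesics *)

Lemma periodically_geodesicP h :
    (forall k : nat, inf_G iota Delta (h ^+ k) = (k%:Z * inf_G iota Delta h)%R) ->
    (forall k : nat, sup_G iota Delta (h ^+ k) = (k%:Z * sup_G iota Delta h)%R) ->
  periodically_geodesic (simples iota Delta) h.
Proof.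
move=> infX supX.
have lenX k : word_length (simples iota Delta) (h ^+ k) =
    (k * word_length (simples iota Delta) h)%N.
  by rewrite !word_lengthE infX supX; nia.
case=> k; first exact: lenX.
(* For negative powers, inversion merely swaps the two summands of the length. *)
by rewrite /expgz -[RHS]lenX !word_lengthE !sup_GE invgK addnC.
Qed.

(** The limit rate [p / q] is already attained at [q], hence at its multiples. For a conjugate [h]
    attaining it, [leG_expg] bounds inf of the powers of [h] from below and the rate bounds it from
    above. *)
Lemma summit_power g (q m : nat) (p : int) : (0 < q)%N -> (0 < m)%N ->
    raises (g ^+ q) p ->
    (forall (k : nat) (b : int), (0 < k)%N -> raises (g ^+ k) b ->
        (q%:Z * b <= p * k%:Z)%R) ->
  inf_s iota Delta (g ^+ (q * m)) = (m%:Z * p)%R /\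
  forall h, conj_class (g ^+ (q * m)) h -> inf_G iota Delta h = (m%:Z * p)%R ->
  forall k : nat, inf_G iota Delta (h ^+ k) = (k%:Z * inf_G iota Delta h)%R.
Proof.
move=> q0 m0 gp slope.
have ub (k : nat) (b : int) : (0 < k)%N -> raises (g ^+ (q * m * k)) b ->
    (b <= k%:Z * (m%:Z * p))%R.
  by move=> k0 /slope; rewrite !muln_gt0 q0 m0 k0 => /(_ isT); nia.
split.
  apply: inf_sE; first by rewrite expgnA; apply: raises_expg.
  by move=> r; rewrite -[(q * m)%N]muln1 => /ub-/(_ isT); rewrite mul1r.
move=> h [u _ <-] infh [|k].
  rewrite mul0r; apply: inf_GE => [|r]; first exact: leG_refl.
  by move=> /(@leG_DD _ 0%R).
apply: inf_GE => [|r rh]; first by apply: leG_expg; have [] := inf_GP (g ^+ (q * m) ^ u).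
by rewrite infh; apply: ub => //; exists u; rewrite expgnA conjXg.
Qed.

Lemma super_summit_periodically_geodesic g : exists n : nat,
  [/\ (0 < n)%N, (n <= atom_norm Delta ^ 2)%N
    & forall h, super_summit_set iota Delta (g ^+ n) h ->
        periodically_geodesic (simples iota Delta) h].
Proof.
have [q1 [p1 [/andP[q1_0 q1N] gp1 slope1]]] := raises_slope g.
have [q2 [p2 [/andP[q2_0 q2N] gp2 slope2]]] := raises_slope g^-1.
(* The exponent [q1 * q2] is a multiple of both denominators, so it serves [g] for inf and [g^-1]
   for sup. *)
have [inf_n inf_X] := summit_power q1_0 q2_0 gp1 slope1.
have [sup_n sup_X] := summit_power q2_0 q1_0 gp2 slope2.
rewrite mulnC in sup_n sup_X.
exists (q1 * q2)%N; split; [by rewrite muln_gt0 q1_0|by rewrite expnS expn1 leq_mul|].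
move=> h [gh infh suph]; apply: periodically_geodesicP.
  by apply: inf_X; rewrite // infh.
move=> k; rewrite !sup_GE -expVgn sup_X ?mulrN //.
  by have [u _ <-] := gh; exists u; rewrite // -conjVg expVgn.
by apply: oppr_inj; rewrite -sup_GE suph sup_sE -expVgn sup_n.
Qed.

End GarsideOrder.

Theorem theoremA (M : monoidType) (G : groupType)
    (iota : UMagmaMorphism.type M G) (Delta : M)
    (hM : garside_monoid Delta) (hG : group_of_fractions iota)
    (hpos : positive iota <> [set 1]) (g : G) :
  exists n : nat,
    [/\ (0 < n)%N, (n <= atom_norm Delta ^ 2)%N
      & forall h : G, super_summit_set iota Delta (g ^+ n) h ->
          periodically_geodesic (simples iota Delta) h].
Proof.
(* If [Delta = 1], every simple element is 1, and simples generate, so the positive monoid is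
   trivial. *)
apply: super_summit_periodically_geodesic => // Delta1; apply: hpos.
have trivM (a : M) : a = 1.
  have [_ /(_ a)[s sD <-]] := garside_delta hM.
  apply: big1_seq => x /= /sD [c]; rewrite Delta1; exact: (mul_eq1 hM).
apply/seteqP; split=> [_ [a _ <-]|_ ->] /=; first by rewrite (trivM a) gmulf1.
by exists 1; rewrite ?gmulf1.
Qed.
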